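(* Let $\boldsymbol{z}=(z_n)_{n\ge 0}$ be the increasing sequence with $\{z_n \mid n\in\mathbb{N}\}=\{m\in\mathbb{N}\mid d_m=0\}$, where $\boldsymbol{d}=(d_n)_{n\ge 0}$ is the period-doubling sequence. Then $\boldsymbol{z}$ is not $k$-regular for any integer $k\ge 2$.
   Context: $\mathbb{N}=\{0,1,2,\ldots\}$. The period-doubling sequence $\boldsymbol{d}=(d_n)_{n\ge 0}$ is defined by $d_n=\nu_2(n+1) \bmod 2\in\{0,1\}$, where $\nu_2(m)$ is the exponent of the highest power of $2$ dividing $m$. For an integer $k\ge 2$, the $k$-kernel of a sequence $(s_n)_{n\ge 0}$ is the set of subsequences $\{(s_{k^i n+r})_{n\ge 0}\mid i\ge 0,\ 0\le r<k^i\}$. An integer sequence is $k$-regular if there exists a finite set $S$ of (integer) sequences such that every sequence in its $k$-kernel is a $\mathbb{Z}$-linear combination of sequences of $S$. *)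

(* Defs.v *)
From mathcomp Require Import all_boot all_order all_algebra.

Set Implicit Arguments.
Unset Strict Implicit.
Unset Printing Implicit Defensive.

Local Open Scope nat_scope.

Definition period_doubling (n : nat) : nat := logn 2 n.+1 %% 2.

(* Sequences are functions on [nat], identified up to pointwise equality. *)
Definition in_kernel (k : nat) (s t : nat -> int) : Prop :=
  exists i r : nat, r < k ^ i /\ t =1 (fun n => s (k ^ i * n + r)).

Definition Zlinear_combination (m : nat) (S : 'I_m -> nat -> int)
    (t : nat -> int) : Prop :=
  exists c : 'I_m -> int, forall n, t n = (\sum_(j < m) c j * S j n)%R.

(* The finite set of sequences is given as a finite family, possibly with
   repetitions. *)
Definition regular (k : nat) (s : nat -> int) : Prop :=
  exists (m : nat) (S : 'I_m -> nat -> int),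
    forall t, in_kernel k s t -> Zlinear_combination S t.

(* Main.v *)
Require Import Defs.
From mathcomp Require Import all_boot all_order all_algebra.
From mathcomp Require Import cyclic zify ring.

Set Implicit Arguments.
Unset Strict Implicit.
Unset Printing Implicit Defensive.

Local Open Scope nat_scope.

(** The proof writes [d] for the period-doubling sequence and [c(N)], the
    function [zero_count], for the number of zeros of [d] below [N]; thus [c]
    and [z] are inverse to each other on the zeros of [d].

    The first ingredient is that [d] looks alike near all multiples of [2^t]:
    if [2^t] divides [N] then [d] agrees with its own prefix on
    [N, N + 2^t - 1), so [c(N + u) = c(N) + c(u)] for [u < 2^t], and therefore
    [z(c(N) + n) = N + z(n)] as long as [z(n) + 1 < 2^t] (lemma
    [zeros_shift]).

    The second ingredient is that [c(N)] takes every residue modulo every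
    [K > 0] on the multiples [N] of any fixed power of 2 ([attained_all]).
    Together they show ([zeros_factor_aligned]) that every finite piece
    [z(p), ..., z(p + K - 1)] reappears, up to an additive constant, at an index
    divisible by [K].  Powers of the base [k] that share factors with 2 and
    those that do not are thereby treated at once.

    Suppose now that [z] is [k]-regular, with a finite family of [m] sequences
    spanning the kernel.  Put [K = k^i].  The block
    [z(K n), ..., z(K n + K - 1)] is the image of the vector [(S_j(n))_j] under
    a linear map that depends only on [K].  Hence any [m + 1] such blocks
    satisfy a nontrivial linear relation, whatever [K] is.  By the second
    ingredient the same holds, up to additive constants, for any [m + 1]
    pieces of [z] of length [K].

    This fails for the pieces that start at the indices [p_x = c(4^(x+1))],
    where [x = 0, ..., m], once [K > p_m].  Indeed
    [z(p_x + r) - 4^(x+1) - z(r)] vanishes for [r < p_x - 1] by [zeros_shift],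
    but not for [r = p_x - 1]: here [z(r) = 4^(x+1) - 1], and
    [d] is 1 at [2 * 4^(x+1) - 1].  So the pieces form a triangular system
    ([pieces_independent]). *)

(** * Counting the zeros of the period-doubling sequence *)

Definition zero_count (N : nat) : nat := \sum_(i < N) (period_doubling i == 0).

Lemma zero_countS N :
  zero_count N.+1 = zero_count N + (period_doubling N == 0).
Proof. by rewrite /zero_count big_ord_recr. Qed.

Lemma zero_count0 : zero_count 0 = 0.
Proof. by rewrite /zero_count big_ord0. Qed.

Lemma period_doubling_even n : period_doubling n.*2 = 0.
Proof.
by rewrite /period_doubling logn_coprime // coprime2n /= odd_double.
Qed.

Lemma period_doubling_odd n :
  (period_doubling n.*2.+1 == 0) = (period_doubling n != 0).
Proof.
rewrite /period_doubling -doubleS -mul2n lognM // logn_prime // eqxx !modn2.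
by rewrite add1n oddS; case: (odd _).
Qed.

(** Below [2N], all [N] even indices are zeros of [d], and the odd indices are
    zeros exactly when their halves are not. *)
Lemma zero_count_double N : zero_count N.*2 + zero_count N = N.*2.
Proof.
elim: N => [|N IH]; first by rewrite zero_count0.
rewrite doubleS !zero_countS period_doubling_even period_doubling_odd eqxx.
case: (period_doubling N == 0) => /=; lia.
Qed.

(** The 2-adic valuations of [N + u + 1] and [u + 1] agree when
    [0 < u + 1 < 2^t] and [2^t] divides [N]. *)
Lemma period_doubling_shift t N u : 2 ^ t %| N -> u.+1 < 2 ^ t ->
  (period_doubling (N + u) == 0) = (period_doubling u == 0).
Proof.
move=> /dvdnP[M ->] {N}; elim: t u => [|t IH] u; first by rewrite expn0.
rewrite expnS => ult.
have -> : M * (2 * 2 ^ t) = (M * 2 ^ t).*2 by rewrite mulnCA mul2n.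
rewrite -(odd_double_half u); case odd_u: (odd u).
  by rewrite add1n addnS -doubleD !period_doubling_odd IH //; lia.
by rewrite add0n -doubleD !period_doubling_even.
Qed.

Lemma zero_countD t N u : 2 ^ t %| N -> u < 2 ^ t ->
  zero_count (N + u) = zero_count N + zero_count u.
Proof.
move=> dvN; elim: u => [|u IH] ult; first by rewrite zero_count0 !addn0.
rewrite addnS !zero_countS IH ?(ltnW ult) //.
by rewrite (period_doubling_shift dvN) // addnA.
Qed.

Lemma zero_count_pow2 l :
  zero_count (2 ^ l.+1) + zero_count (2 ^ l) = 2 ^ l.+1.
Proof. by rewrite expnS mul2n zero_count_double. Qed.

(** The closed form is [3 c(2^l) = 2^(l+1) + (-1)^l]; at odd exponents the
    sign makes two consecutive values coprime with an explicit Bezout relation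
    [c(2^(l+1)) - 2 c(2^l) = 1]. *)
Lemma zero_count_odd_pow2 j :
  zero_count (2 ^ j.*2.+2) = (zero_count (2 ^ j.*2.+1)).*2.+1.
Proof.
have H : 3 * zero_count (2 ^ j.*2.+1) + 1 = 2 ^ j.*2.+2.
  elim: j => [|j IH].
    have := zero_count_double 1; have := zero_count_double 0.
    by rewrite !zero_countS zero_count0 /period_doubling /=; lia.
  have := zero_count_pow2 j.*2.+2; have := zero_count_pow2 j.*2.+1.
  rewrite doubleS; move: IH; rewrite !(expnS 2 _.+2) !(expnS 2 _.+1); lia.
have := zero_count_pow2 j.*2.+1; lia.
Qed.

(** Steps of even length in the exponent keep the sign [(-1)^l] of the closed
    form, which therefore cancels. *)
Lemma zero_count_pow2_step l j :
  3 * zero_count (2 ^ (l + j.*2)) + 2 ^ l.+1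
  = 3 * zero_count (2 ^ l) + 2 ^ l.+1 * 2 ^ j.*2.
Proof.
elim: j => [|j IH]; first by rewrite addn0 muln1.
rewrite doubleS !addnS.
have := zero_count_pow2 (l + j.*2).+1; have := zero_count_pow2 (l + j.*2).
move: IH; rewrite -!expnD !addSn !addnS !expnS; lia.
Qed.

(** By the previous identity, periodicity amounts to the divisibility of
    [2^(l+1) (2^(2 x P) - 1)] by [3 K].  The 2-part of [K] divides the first
    factor as soon as [K <= l]; the rest, including the 3, is odd and divides
    the second one by Euler's theorem. *)
Lemma zero_count_pow2_periodic K : 0 < K ->
  exists2 P, 0 < P & forall l, K <= l -> forall x,
    zero_count (2 ^ (l + (x * P).*2)) = zero_count (2 ^ l) %[mod K].
Proof.
move=> K0; pose K' := K`_2^'.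
have K'0 : 0 < K' by apply: part_gt0.
have cop : coprime 2 (3 * K').
  by rewrite coprimeMr /= coprime2n odd_2'nat part_pnat.
exists (totient (3 * K')); first by rewrite totient_gt0 muln_gt0.
move=> l Kl x; set j := x * _.
have dv : 3 * K' %| 2 ^ j.*2 - 1.
  rewrite -eqn_mod_dvd ?expn_gt0 //; apply/eqP.
  have E := Euler_exp_totient cop.
  have -> : j.*2 = totient (3 * K') * x.*2 by rewrite /j -!mul2n; lia.
  by rewrite expnM -modnXm E modnXm exp1n.
have a_dv : K`_2 %| 2 ^ l.+1.
  rewrite p_part dvdn_exp2l //.
  have := ltn_logl 2 K0; lia.
have dvK : 3 * K %| 2 ^ l.+1 * (2 ^ j.*2 - 1).
  by rewrite -(partnC 2 K0) mulnCA dvdn_mul.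
have := zero_count_pow2_step l j.
case/dvdnP: dvK => q; rewrite mulnBr muln1 => Eq.
move=> E2.
have le : 2 ^ l.+1 <= 2 ^ l.+1 * 2 ^ j.*2 by rewrite leq_pmulr // expn_gt0.
have -> : zero_count (2 ^ (l + j.*2)) = q * K + zero_count (2 ^ l) by lia.
by rewrite modnMDl.
Qed.

(** * Residues of the zero count at highly even numbers *)

(** Asking for solutions divisible by every power of 2 is what makes these
    residues closed under addition: the binary digits of a second solution can
    be placed above those of the first. *)
Definition attained (K g : nat) : Prop :=
  forall t, exists2 N, 2 ^ t %| N & zero_count N = g %[mod K].

Lemma attained0 K : attained K 0.
Proof. by move=> t; exists 0; rewrite ?dvdn0 // zero_count0. Qed.

Lemma attainedD K g h : attained K g -> attained K h -> attained K (g + h).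
Proof.
move=> Ag Ah t; have [N dN EN] := Ag t; have [M dM EM] := Ah (t + N).
exists (M + N).
  by rewrite dvdn_add // (dvdn_trans _ dM) // dvdn_exp2l // leq_addr.
have ltN : N < 2 ^ (t + N).
  by apply: leq_ltn_trans (leq_addl t N) _; apply: ltn_expl.
rewrite (zero_countD dM ltN).
by rewrite -modnDm EN EM modnDm addnC.
Qed.

Lemma attainedM K g q : attained K g -> attained K (q * g).
Proof.
move=> Ag; elim: q => [|q IH]; first exact: attained0.
by rewrite mulSn; apply: attainedD.
Qed.

Lemma attained_pow2 K l : 0 < K -> K <= l -> attained K (zero_count (2 ^ l)).
Proof.
move=> K0 Kl t; have [P P0 HP] := zero_count_pow2_periodic K0.
exists (2 ^ (l + (t * P).*2)); last exact: HP.
by rewrite dvdn_exp2l //; nia.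
Qed.

(** With [w = c(2^l)] for an odd [l >= K], both [w] and [c(2^(l+1)) = 2 w + 1]
    are attained, hence so is [(2 w + 1) + 2 (K - 1) w], which is 1 modulo
    [K]. *)
Lemma attained_all K g : 0 < K -> attained K g.
Proof.
move=> K0; rewrite -[g]muln1; apply: attainedM.
set w := zero_count (2 ^ K.*2.+1).
have Aw : attained K w by apply: attained_pow2; lia.
have Aw2 : attained K w.*2.+1.
  by rewrite -zero_count_odd_pow2; apply: attained_pow2; lia.
have := attainedD Aw2 (attainedM (2 * K.-1) Aw).
have -> : w.*2.+1 + 2 * K.-1 * w = (2 * w) * K + 1.
  by case: K K0 @w Aw Aw2 => // K _ w _ _ /=; nia.
by move=> A t; have [N dN EN] := A t; exists N; rewrite // EN modnMDl.
Qed.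

(** * The increasing enumeration of the zeros *)

Definition enumerates_zeros (z : nat -> nat) : Prop :=
  (forall i j, i < j -> z i < z j) /\
  (forall m, (exists n, z n = m) <-> period_doubling m = 0).

Lemma zeros_mono z : enumerates_zeros z -> {mono z : i j / i < j}.
Proof.
case=> incr _ i j; case: (ltngtP i j) => [/incr //|/incr|->]; last first.
  by rewrite ltnn.
by move=> h; apply/negbTE; rewrite -leqNgt ltnW.
Qed.

Lemma zero_count_gap a b : a <= b ->
  (forall m, a <= m < b -> period_doubling m <> 0) ->
  zero_count b = zero_count a.
Proof.
elim: b => [|b IH]; first by rewrite leqn0 => /eqP->.
rewrite leq_eqVlt => /predU1P[->//|]; rewrite ltnS => ab H.
rewrite zero_countS IH //; last by move=> m Hm; apply: H; lia.
by case: eqP (H b) => [-> /(_ _) []|_ _]; rewrite ?addn0 //; lia.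
Qed.

Lemma zero_count_zeros z n : enumerates_zeros z -> zero_count (z n) = n.
Proof.
move=> Hz; have mono := zeros_mono Hz; have [_ range] := Hz.
elim: n => [|n IH].
  rewrite (@zero_count_gap 0) ?zero_count0 // => m /andP[_ lt] /range[j Ej].
  by move: lt; rewrite -Ej mono.
rewrite (@zero_count_gap (z n).+1) ?mono //.
  have dz : period_doubling (z n) = 0 by apply/range; exists n.
  rewrite zero_countS IH dz.
  by rewrite eqxx addn1.
move=> m /andP[gt lt] /range[j Ej].
by move: gt lt; rewrite -Ej !mono; lia.
Qed.

Lemma zeros_zero_count z m : enumerates_zeros z ->
  period_doubling m = 0 -> z (zero_count m) = m.
Proof.
move=> Hz; have [_ range] := Hz; move/range=> [n <-].
by rewrite zero_count_zeros.
Qed.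

(** Both sides are zeros of [d] preceded by [c(N) + n] zeros: translating by
    [N] preserves the zero [z n] and adds [c(N)] to its rank. *)
Lemma zeros_shift z t N n : enumerates_zeros z ->
  2 ^ t %| N -> (z n).+1 < 2 ^ t -> z (zero_count N + n) = N + z n.
Proof.
move=> Hz dN lt; have [_ range] := Hz.
rewrite -{1}(zero_count_zeros n Hz) -(zero_countD dN) ?(ltnW lt) //.
apply: zeros_zero_count => //; apply/eqP; rewrite (period_doubling_shift dN) //.
by apply/eqP/range; exists n.
Qed.

(** Choose [N], a multiple of a power of 2 exceeding every term of the piece,
    with [c(N) = - p] modulo [K]; the piece is translated by [N] and starts at
    the index [c(N) + p]. *)
Lemma zeros_factor_aligned z K p : enumerates_zeros z -> 0 < K ->
  exists n B, forall r, r < K -> z (K * n + r) = B + z (p + r).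
Proof.
move=> Hz K0; have mono := zeros_mono Hz.
have [N dN EN] := attained_all (K.-1 * p) K0 (z (p + K)).+1.
have : K %| zero_count N + p.
  (* (K - 1) p stands for - p modulo K. *)
  rewrite /dvdn -modnDml EN modnDml -mulSnr prednK //.
  by rewrite modnMr.
case/dvdnP=> n En; exists n, N => r rK.
rewrite mulnC -En -addnA (zeros_shift Hz dN) //.
apply: leq_ltn_trans (ltn_expl _ _) => //.
by rewrite ltnS; apply: ltnW; rewrite mono ltn_add2l.
Qed.

(** * A triangular family of pieces *)

(** The exponent is the even number [2 (x + 1)], so that [4^(x+1) - 1] is a zero
    of [d] and is the zero of index [marker x - 1]. *)
Definition marker (x : nat) : nat := zero_count (2 ^ x.*2.+2).

Lemma period_doubling_pow4_pred x : period_doubling (2 ^ x.*2.+2).-1 = 0.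
Proof.
rewrite /period_doubling prednK ?expn_gt0 // pfactorK //.
by rewrite modn2 /= negbK odd_double.
Qed.

Lemma markerE x : marker x = (zero_count (2 ^ x.*2.+2).-1).+1.
Proof.
have g : 0 < 2 ^ x.*2.+2 by rewrite expn_gt0.
rewrite /marker -{1}(prednK g) zero_countS period_doubling_pow4_pred.
by rewrite eqxx addn1.
Qed.

Lemma zeros_marker z x : enumerates_zeros z ->
  z (marker x).-1 = (2 ^ x.*2.+2).-1.
Proof.
move=> Hz; rewrite markerE /= zeros_zero_count //.
exact: period_doubling_pow4_pred.
Qed.

Lemma marker_agree z x r : enumerates_zeros z ->
  r < (marker x).-1 -> z (marker x + r) = 2 ^ x.*2.+2 + z r.
Proof.
move=> Hz lt; apply: (zeros_shift Hz (dvdnn _)).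
have := zeros_mono Hz r (marker x).-1; rewrite lt zeros_marker //.
have : 0 < 2 ^ x.*2.+2 by rewrite expn_gt0.
lia.
Qed.

(** The left side would otherwise be [2 * 4^(x+1) - 1], which is not a zero of
    [d] since [2 * 4^(x+1)] has odd valuation. *)
Lemma marker_differ z x : enumerates_zeros z ->
  z (marker x + (marker x).-1) <> 2 ^ x.*2.+2 + z (marker x).-1.
Proof.
move=> Hz; rewrite (zeros_marker x Hz) => E; have [_ range] := Hz.
have : period_doubling (2 ^ x.*2.+2 + (2 ^ x.*2.+2).-1) = 0.
  by apply/range; eexists; exact: E.
rewrite /period_doubling -addnS prednK ?expn_gt0 // addnn -mul2n -expnS.
by rewrite pfactorK // modn2 /= negbK odd_double.
Qed.

Lemma marker_mono z x y : enumerates_zeros z ->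
  x < y -> (marker x).-1 < (marker y).-1.
Proof.
move=> Hz xy; rewrite -(zeros_mono Hz) !zeros_marker //.
have := expn_gt0 2 x.*2.+2.
have : 2 ^ x.*2.+2 < 2 ^ y.*2.+2 by rewrite ltn_exp2l //; lia.
lia.
Qed.

Lemma marker_gt1 z x : enumerates_zeros z -> 1 < (marker x).-1.
Proof.
move=> Hz.
have lt0 : 1 < (marker 0).-1 by rewrite markerE /= !zero_countS zero_count0.
by have [->|/(marker_mono Hz)] := posnP x; last lia.
Qed.

(** * Linear independence of the pieces *)

Import GRing.Theory Num.Theory.
Local Open Scope ring_scope.

Lemma tall_matrix_left_kernel (F : fieldType) (m : nat) (V : 'M[F]_(m.+1, m)) :
  exists2 a : 'rV[F]_m.+1, a != 0 & a *m V = 0.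
Proof.
have : kermx V != 0.
  rewrite -mxrank_eq0 mxrank_ker subn_eq0 -ltnNge ltnS; exact: rank_leq_col.
by case/rowV0Pn=> a /sub_kermxP aV a0; exists a.
Qed.

(** The unknown constants and the common summand [z r] are eliminated first:
    the columns [r = 0] and [r = 1] lie before the first discrepancy, and
    [z 0 <> z 1] forces both the sum of the [a x] and the constant term to
    vanish.  The discrepancies that remain form a triangular matrix. *)
Lemma pieces_independent z m (a C : 'I_m.+1 -> rat) : enumerates_zeros z ->
  (forall r, (r < marker m)%N ->
     \sum_x a x * (C x + (z (marker x + r))%:R) = 0) ->
  forall x, a x = 0.
Proof.
move=> Hz H.
pose C' (x : 'I_m.+1) : rat := C x + (2 ^ x.*2.+2)%N%:R.
pose D (x : 'I_m.+1) (r : nat) : rat :=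
  (z (marker x + r))%:R - (2 ^ x.*2.+2 + z r)%N%:R.
have D0 (x : 'I_m.+1) r : (r < (marker x).-1)%N -> D x r = 0.
  by move=> lt; rewrite /D marker_agree // subrr.
have DN0 (x : 'I_m.+1) : D x (marker x).-1 != 0.
  by rewrite /D subr_eq0 eqr_nat; apply/eqP/marker_differ.
have rel r : (r < marker m)%N ->
    \sum_x a x * C' x + (\sum_x a x) * (z r)%:R + \sum_x a x * D x r = 0.
  move=> /H E; rewrite -[RHS]E mulr_suml -!big_split /=; apply: eq_bigr => x _.
  rewrite -!mulrDr; congr (_ * _); rewrite /C' /D natrD; ring.
have small r : (r <= 1)%N ->
    \sum_x a x * C' x + (\sum_x a x) * (z r)%:R = 0.
  move=> r1; have lt y : (r < (marker y).-1)%N.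
    by apply: leq_ltn_trans r1 (marker_gt1 _ Hz).
  rewrite -[RHS](rel r); last by have := lt m; lia.
  by rewrite [X in _ = _ + X]big1 ?addr0 // => x _; rewrite D0 ?mulr0.
have z0 : z 0%N = 0%N by rewrite -[RHS](zeros_zero_count Hz) ?zero_count0.
have z1 : z 1%N = 2%N.
  by rewrite -[RHS](zeros_zero_count Hz) // !zero_countS zero_count0.
have A0 : \sum_x a x * C' x = 0.
  by have := small 0%N isT; rewrite z0 mulr0 addr0.
have B0 : \sum_x a x = 0.
  by have /eqP := small 1%N isT; rewrite z1 A0 add0r mulf_eq0 orbF => /eqP.
move=> x; have [n le] := ubnP (x : nat); elim: n x le => // n IH x le.
(* In column [marker x - 1] the later pieces show no discrepancy yet, and the
   coefficients of the earlier ones vanish by induction. *)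
have := rel (marker x).-1; rewrite A0 B0 mul0r !add0r.
rewrite (bigD1 x) //= big1 ?addr0 => [E|y yx].
  have lt : ((marker x).-1 < marker m)%N.
    have := ltn_ord x; rewrite ltnS leq_eqVlt => /predU1P[->|].
      by have := marker_gt1 m Hz; lia.
    by move/(marker_mono Hz); lia.
  by have /eqP := E lt; rewrite mulf_eq0 (negPf (DN0 x)) orbF => /eqP.
have [ltxy|ltyx|eqxy] := ltngtP x y.
- by rewrite D0 ?mulr0 // (marker_mono Hz).
- by rewrite IH ?mul0r //; lia.
- by rewrite (ord_inj eqxy) eqxx in yx.
Qed.

Theorem proposition5 (z : nat -> nat)
    (z_incr : forall i j : nat, (i < j)%N -> (z i < z j)%N)
    (z_range : forall m : nat, (exists n : nat, z n = m) <-> period_doubling m = 0%N)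
    (k : nat) (k_ge2 : (2 <= k)%N) :
  ~ regular k (fun n : nat => (z n)%:Z%R).
Proof.
have Hz : enumerates_zeros z by [].
move=> [m [S reg]].
(* Any exponent i with marker m <= k ^ i would do. *)
pose K := (k ^ marker m)%N.
have K0 : (0 < K)%N by rewrite expn_gt0; lia.
have bigK : (marker m < K)%N by apply: ltn_expl.
have /fin_all_exists[n /fin_all_exists[B HB]] :
    forall x : 'I_m.+1, exists n B, forall r, (r < K)%N ->
      z (K * n + r)%N = (B + z (marker x + r))%N.
  by move=> x; apply: zeros_factor_aligned.
(* The m + 1 vectors (S_j (n x))_j lie in a space of dimension m. *)
have [a a0 aV] :=
  tall_matrix_left_kernel (\matrix_(x < m.+1, j < m) ((S j (n x))%:~R : rat)).
case/negP: a0; apply/eqP/rowP=> x; rewrite mxE.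
apply: (@pieces_independent z m (a 0) (fun y => (B y)%:R) Hz) => r rlt.
have rK := ltn_trans rlt bigK.
have [|c Hc] := reg (fun n => (z (K * n + r)%N)%:Z).
  by exists (marker m), r.
under eq_bigr => y _ do rewrite -natrD -HB // pmulrn Hc rmorph_sum mulr_sumr.
rewrite exchange_big big1 //= => j _.
under eq_bigr => y _ do rewrite rmorphM mulrCA.
rewrite -mulr_sumr.
have := congr1 (fun M : 'rV_m => M 0 j) aV; rewrite !mxE.
by under eq_bigr do rewrite mxE; move=> ->; rewrite mulr0.
Qed.
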